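(* For all integers $n,k\geq 0$ and indeterminate $y$, $$\sum_{j=0}^{n}\binom{n}{j}A_{k+j,k}(y+1)^{n-j}=\sum_{j=0}^{n}\binom{n}{j}B_{k+j}y^{n-j},$$ $$\sum_{j=0}^{n}\binom{n}{j}A_{k+j,k}B_{n-j+1}(y)=y\sum_{j=0}^{n}\binom{n}{j}B_{k+j}B_{n-j}(y),$$ $$\sum_{j=0}^{n}\binom{n}{j}\binom{y+n-j}{n-j}A_{k+j,k}=\sum_{j=0}^{n}\binom{n}{j}\binom{y}{n-j}B_{k+j}.$$
   Context: A partition of a finite set is a collection of nonempty, pairwise disjoint subsets (blocks) whose union is the set; a singleton of a partition is a block with exactly one element. $B_n$ denotes the $n$-th Bell number ($B_0=1$), $B_k(y)=\sum_{j=0}^{k}S(k,j)y^j$ is the $k$-th Bell polynomial ($S(k,j)$ Stirling numbers of the second kind), and for an indeterminate $y$, $\binom{y}{k}=\frac{y(y-1)\cdots(y-k+1)}{k!}$. For integers $0\leq k\leq n$, $A_{n,k}$ denotes the number of partitions of $\{1,2,\dots,n+1\}$ whose largest singleton is $k+1$ (i.e. $\{k+1\}$ is a block and no $j>k+1$ forms a singleton block). *)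

(* Defs.v *)
From mathcomp Require Import all_boot all_order all_algebra.
Set Implicit Arguments.
Unset Strict Implicit.
Unset Printing Implicit Defensive.
Import GRing.Theory.
Local Open Scope ring_scope.

(* The ground set {1, ..., n} is encoded as 'I_n, the ordinal of value i
   standing for the element i + 1. *)

Definition set_partitions (n : nat) : {set {set {set 'I_n}}} :=
  [set P : {set {set 'I_n}} | partition P [set: 'I_n]].

Definition bell (n : nat) : nat := #|set_partitions n|.

Definition stirling2 (n j : nat) : nat :=
  #|[set P in set_partitions n | #|P| == j]|.

(* With the encoding above, the element k + 1 is the ordinal of value k. *)
Definition largest_singleton (n k : nat) (P : {set {set 'I_n}}) : bool :=
  [exists i : 'I_n,
    [&& val i == k, [set i] \in P
      & [forall j : 'I_n, (i < j)%N ==> ([set j] \notin P)]]].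

Definition Anum (n k : nat) : nat :=
  #|[set P in set_partitions n.+1 | largest_singleton k P]|.

Definition bell_poly (k : nat) : {poly rat} :=
  \sum_(0 <= j < k.+1) (stirling2 k j)%:R * 'X^j.

Definition binom_poly (p : {poly rat}) (k : nat) : {poly rat} :=
  (k`!%:R)^-1 *: \prod_(0 <= i < k) (p - i%:R).

(* Main.v *)
Require Import Defs.
From mathcomp Require Import all_boot all_order all_algebra.
From mathcomp Require Import zify ring.
Import GRing.Theory.

(** Deleting the singletons among the last [n] elements of a partition of a
    [(k + n)]-element set gives [B_(k+n) = \sum_j 'C(n, j) A_(k+j,k)], so
    [j |-> B_(k+j)] is the binomial transform of [j |-> A_(k+j,k)].  The sequences
    [(y+1)^m], [B_(m+1)(y)] and [binom(y+m, m)] are the binomial transforms of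
    [y^m], [y B_m(y)] and [binom(y, m)], by the binomial theorem, by deleting the
    block of a given element, and by Vandermonde's identity.  In a binomial
    convolution the transform can be moved from one factor to the other, which
    is each of the three identities. *)

(** * Removing a block from a partition *)

(** Deleting [B] is injective on partitions containing it and is undone by [B |: Q]; as [B] is
    nonempty, it cannot already be a block of a partition [Q] of [S :\: B]. *)
Lemma card_partitions_block (T : finType) (S B : {set T})
    (q : pred {set {set T}}) :
    B \subset S -> B != set0 ->
  #|[set P | [&& partition P S, B \in P & q (P :\ B)]]| =
  #|[set Q | partition Q (S :\: B) & q Q]|.
Proof.
move=> sBS nB0; set X := [set P | _]; set Y := [set Q | _].
have <- : [set P :\ B | P in X] = Y.
  apply/setP => Q; apply/imsetP/idP => [[P]|].
    rewrite !inE => /and3P[partP BP qP] ->.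
    by rewrite partitionD1.
  rewrite inE => /andP[partQ qQ].
  have BQ : B \notin Q.
    apply/negP => /(partitionS partQ) /subsetP sB.
    case/set0Pn: nB0 => y yB; have := sB y yB.
    by rewrite !inE yB.
  exists (B |: Q); last by rewrite setU1K.
  rewrite !inE eqxx setU1K // qQ !andbT.
  have BS : B :|: S :\: B = S by rewrite -{1}(setIidPr sBS) setID.
  rewrite -[X in partition _ X]BS; apply: partitionU1 => //.
  by rewrite -setI_eq0 setDE setIC -setIA [~: B :&: B]setIC setICr setI0.
rewrite card_in_imset // => P1 P2; rewrite !inE => /and3P[_ B1 _] /and3P[_ B2 _].
by move=> eqP12; rewrite -(setD1K B1) eqP12 setD1K.
Qed.

Definition no_singleton_in {T : finType} (E : {set T}) (P : {set {set T}}) :=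
  [forall x in E, [set x] \notin P].

Definition singleton_free {T : finType} (S E : {set T}) : nat :=
  #|[set P | partition P S & no_singleton_in E P]|.

Lemma card_partitions_singleton (T : finType) (S E : {set T}) (x : T) :
    x \in S -> x \notin E ->
  #|[set P | [&& partition P S, [set x] \in P & no_singleton_in E P]]| =
  singleton_free (S :\ x) E.
Proof.
move=> xS xE; rewrite /singleton_free -card_partitions_block ?sub1set //.
  apply: eq_card => P; rewrite !inE; congr [&& _, _ & _].
  apply: eq_forallb_in => y yE.
  by rewrite !inE (inj_eq set1_inj); case: eqVneq yE xE => [-> ->|].
by apply/set0Pn; exists x; rewrite inE.
Qed.

(** Either [[set x]] is not a block, so [x] joins the forbidden set, or it is one and can be
    deleted. *)
Lemma singleton_free_rec (T : finType) (S E : {set T}) (x : T) :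
    x \in S -> x \notin E ->
  singleton_free S E = singleton_free S (x |: E) + singleton_free (S :\ x) E.
Proof.
move=> xS xE; rewrite -card_partitions_singleton // /singleton_free.
rewrite -(cardsID [set P : {set {set T}} | [set x] \in P]) addnC; congr (_ + _).
  apply: eq_card => P; rewrite !inE andbCA; congr (_ && _).
  apply/andP/forall_inP => [[nx /forall_inP nE] y|n].
    by rewrite !inE => /orP[/eqP->|/nE].
  split; first by apply: n; rewrite !inE eqxx.
  by apply/forall_inP => y yE; apply: n; rewrite !inE yE orbT.
by apply: eq_card => P; rewrite !inE -andbA; congr (_ && _); rewrite andbC.
Qed.

(** * Counting partitions by their number of blocks *)

Definition block_count {T : finType} (S : {set T}) (j : nat) : nat :=
  #|[set P | partition P S & #|P| == j]|.

(** Partitions are sorted by the block of [x], which is [x |: A]; deleting it leaves [j] blocks. *)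
Lemma block_countS (T : finType) (S : {set T}) (x : T) (j : nat) : x \in S ->
  block_count S j.+1 =
  \sum_(A : {set T} | A \subset S :\ x) block_count ((S :\ x) :\: A) j.
Proof.
move=> xS; rewrite /block_count -sum1dep_card.
rewrite (partition_big (fun P => pblock P x :\ x)
                       (fun A : {set T} => A \subset S :\ x)) /=; last first.
  move=> P /andP[partP _]; apply: setSD; apply: (partitionS partP).
  by rewrite pblock_mem // (cover_partition partP).
apply: eq_bigr => A sA; rewrite sum1dep_card.
have xA : x \notin A by apply/negP => /(subsetP sA); rewrite !inE eqxx.
rewrite setDDl -card_partitions_block; last 2 first.
- rewrite subUset sub1set xS /=; apply: subset_trans sA _; exact: subD1set.
- by apply/set0Pn; exists x; rewrite !inE eqxx.
apply: eq_card => P; rewrite !inE -andbA.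
case partP : (partition P S) => //=.
have xP : x \in cover P by rewrite (cover_partition partP).
have -> : (pblock P x :\ x == A) = (x |: A \in P).
  apply/eqP/idP => [<-|AP]; first by rewrite setD1K ?pblock_mem // mem_pblock.
  by rewrite (def_pblock (partition_trivIset partP) AP) ?setU1K // !inE eqxx.
rewrite andbC; case AP : (_ \in P) => //=.
by rewrite (cardsD1 (x |: A) P) AP.
Qed.

Lemma sum_subset_card (T : finType) (D : {set T}) (g : nat -> nat) :
  \sum_(A : {set T} | A \subset D) g #|A| =
  \sum_(i < #|D|.+1) 'C(#|D|, i) * g i.
Proof.
rewrite (partition_big (fun A : {set T} => inord #|A| : 'I_#|D|.+1) predT) //=.
apply: eq_bigr => i _.
rewrite (eq_bigl (fun A : {set T} => A \in
   [set A : {set T} | A \subset D & #|A| == i])); last first.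
  move=> A; rewrite inE; case sA : (A \subset D) => //=.
  by rewrite -val_eqE /= inordK // ltnS subset_leq_card.
rewrite -cards_draws -sum_nat_const; apply: eq_bigr => A.
by rewrite inE => /andP[_ /eqP->].
Qed.

Lemma sum_bin_rev (n : nat) (g : nat -> nat) :
  \sum_(i < n.+1) 'C(n, i) * g (n - i) = \sum_(i < n.+1) 'C(n, i) * g i.
Proof.
rewrite (reindex_inj rev_ord_inj) /=; apply: eq_bigr => i _.
by rewrite subSS bin_sub ?subKn // -ltnS.
Qed.

Lemma block_count0 (T : finType) (S : {set T}) :
  block_count S 0 = (#|S| == 0) :> nat.
Proof.
rewrite /block_count cards_eq0; case: eqVneq => [->|S0] /=.
  rewrite -(cards1 (set0 : {set {set T}})); apply: eq_card => P.
  by rewrite !inE partition_set0 cards_eq0 andbb.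
apply/eqP; rewrite cards_eq0; apply/eqP/setP => P; rewrite !inE cards_eq0.
apply/negbTE/negP => /andP[/cover_partition + /eqP P0].
by rewrite P0 /cover big_set0 => /esym/eqP; apply/negP.
Qed.

Lemma block_count_set0S (T : finType) (j : nat) :
  block_count (set0 : {set T}) j.+1 = 0.
Proof.
apply/eqP; rewrite cards_eq0; apply/eqP/setP => P; rewrite !inE partition_set0.
by apply/negbTE/negP => /andP[/eqP-> ]; rewrite cards0.
Qed.

Lemma stirling2E (n j : nat) : stirling2 n j = block_count [set: 'I_n] j.
Proof. by apply: eq_card => P; rewrite !inE. Qed.

Lemma block_count_stirling2 (T : finType) (S : {set T}) (j : nat) :
  block_count S j = stirling2 #|S| j.
Proof.
rewrite stirling2E.
elim: j T S => [|j IHj] T S; first by rewrite !block_count0 cardsT card_ord.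
(* This recursion sees [W] only through its cardinality, so applying it to [S] and to its standard
   copy replaces transport along a bijection. *)
suff rec (U : finType) (W : {set U}) : block_count W j.+1 =
    if #|W| is m.+1
    then \sum_(i < m.+1) 'C(m, i) * block_count [set: 'I_i] j else 0.
  by rewrite !rec cardsT card_ord.
have [->|[x xW]] := set_0Vmem W; first by rewrite cards0 block_count_set0S.
rewrite (cardsD1 x W) xW add1n (block_countS _ _ _ j xW).
rewrite -(sum_bin_rev _ (fun i => block_count [set: 'I_i] j)).
rewrite -(sum_subset_card _ _ (fun i => block_count [set: 'I_(_ - i)] j)); apply: eq_bigr => A sA.
by rewrite IHj cardsDS.
Qed.

Lemma stirling2S0 (n : nat) : stirling2 n.+1 0 = 0.
Proof. by rewrite stirling2E block_count0 cardsT card_ord. Qed.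

(** Here [i] is the number of elements outside the block of [ord0]. *)
Lemma stirling2SS (n j : nat) :
  stirling2 n.+1 j.+1 = \sum_(i < n.+1) 'C(n, i) * stirling2 i j.
Proof.
have cD : #|[set: 'I_n.+1] :\ ord0| = n.
  by have := cardsD1 ord0 [set: 'I_n.+1]; rewrite inE cardsT card_ord => -[].
rewrite stirling2E (block_countS _ _ ord0) ?inE //.
rewrite -(sum_bin_rev _ (fun i => stirling2 i j)).
transitivity (\sum_(i < #|[set: 'I_n.+1] :\ ord0|.+1)
  'C(#|[set: 'I_n.+1] :\ ord0|, i) *
  stirling2 (#|[set: 'I_n.+1] :\ ord0| - i) j); last by rewrite !cD.
rewrite -(sum_subset_card _ _ (fun i => stirling2 (_ - i) j)).
apply: eq_bigr => A sA.
by rewrite block_count_stirling2 cardsDS.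
Qed.

Lemma stirling2_small (n j : nat) : n < j -> stirling2 n j = 0.
Proof.
elim: j n => // j IHj [|n] ltnj.
  rewrite stirling2E (_ : [set: 'I_0] = set0) ?block_count_set0S //.
  by apply/setP => -[].
rewrite stirling2SS big1 // => i _; rewrite IHj ?muln0 //.
by rewrite (leq_trans (ltn_ord i)).
Qed.

(** Both counts are the same sum of Stirling numbers. Blocks are nonempty, so there are at most
    [#|S|] of them. *)
Lemma card_partitions_bell (T : finType) (S : {set T}) :
  #|[set P | partition P S]| = bell #|S|.
Proof.
have countE (U : finType) (W : {set U}) :
    #|[set P | partition P W]| = \sum_(j < #|W|.+1) stirling2 #|W| j.
  rewrite -sum1dep_card.
  rewrite (partition_big (fun P : {set {set U}} => inord #|P| : 'I_#|W|.+1)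
                         predT) //=.
  apply: eq_bigr => j _; rewrite -block_count_stirling2 sum1dep_card.
  apply: eq_card => P; rewrite !inE; case partP : (partition P W) => //=.
  rewrite -val_eqE /= inordK // ltnS (card_partition partP) -sum1_card.
  apply: leq_sum => B BP; rewrite card_gt0.
  exact: partition_neq0 partP BP.
by rewrite countE /bell countE cardsT card_ord.
Qed.

(** * Partitions without prescribed singletons *)

(* The number of partitions of an [s]-element set without singletons in a given
   [e]-element subset; for [e <= s] the subtraction never truncates. *)
Fixpoint bell_diff (s e : nat) : nat :=
  if e is e'.+1 then bell_diff s e' - bell_diff s.-1 e' else bell s.

(** Induction on [#|E|]: solving [singleton_free_rec] for its first summand gives the difference
    defining [bell_diff]. *)
Lemma singleton_free_bell_diff (T : finType) (S E : {set T}) :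
  E \subset S -> singleton_free S E = bell_diff #|S| #|E|.
Proof.
move: {2}#|E| (erefl #|E|) => e cE; rewrite cE.
elim: e S E cE => [|e IHe] S E cE sES.
  rewrite /= -card_partitions_bell; apply: eq_card => P; rewrite !inE.
  move/eqP: cE; rewrite cards_eq0 => /eqP->.
  by case: (partition P S) => //=; apply/forall_inP => x; rewrite inE.
have /card_gt0P[x xE] : 0 < #|E| by rewrite cE.
have xS := subsetP sES x xE.
have xEx : x \notin E :\ x by rewrite !inE eqxx.
have cEx : #|E :\ x| = e.
  by have := cardsD1 x E; rewrite xE cE => -[].
have cSx : #|S :\ x| = #|S|.-1 by rewrite (cardsD1 x S) xS.
have := singleton_free_rec _ _ _ _ xS xEx.
rewrite setD1K // (IHe _ _ cEx) ?(subset_trans (subD1set _ _)) //.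
rewrite (IHe _ _ cEx) ?setSD // cSx /= => ->.
by rewrite addnK.
Qed.

(** Of [m] elements outside [E], [j] are declared non-singletons and join [E], while the other
    [m - j] are deleted as singletons. The induction on [m] treats one element at a time and is
    closed by Pascal's rule. *)
Lemma singleton_free_sum_bin (T : finType) (S E : {set T}) (k m : nat) :
    E \subset S -> #|S| = k + m + #|E| ->
  singleton_free S E =
  \sum_(j < m.+1) 'C(m, j) * bell_diff (k + #|E| + j) (#|E| + j).
Proof.
elim: m S E => [|m IHm] S E sES cS.
  by rewrite big_ord1 bin0 mul1n singleton_free_bell_diff // cS !addn0.
have /card_gt0P[x] : 0 < #|S :\: E| by rewrite cardsDS // cS addnK addnS.
rewrite inE => /andP[xE xS].
have cxE : #|x |: E| = #|E|.+1 by rewrite cardsU1 xE.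
have cSx : #|S :\ x| = #|S|.-1 by rewrite (cardsD1 x S) xS.
rewrite (singleton_free_rec _ _ _ x) // IHm; last 2 first.
- by rewrite subUset sub1set xS.
- by rewrite cxE cS !addnS addSn.
rewrite IHm; last 2 first.
- by rewrite subsetD1 sES.
- by rewrite cSx cS addnS addSn.
rewrite cxE [RHS]big_ord_recl [X in _ + X = _]big_ord_recl !bin0.
rewrite addnCA; congr (_ + _).
under [in RHS]eq_bigr => i _ do rewrite /= binS mulnDl.
rewrite big_split /= addnC; congr (_ + _); last first.
  by apply: eq_bigr => i _; rewrite /bump add1n !addnS !addSn.
by rewrite big_ord_recr /= bin_small // mul0n addn0.
Qed.

(** Deleting the largest singleton leaves [k + j] elements, and the [j] elements above it, collected
    in [E], must not be singletons. *)
Lemma Anum_bell_diff (k j : nat) : Anum (k + j) k = bell_diff (k + j) j.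
Proof.
have ltk : k < (k + j).+1 by lia.
pose x := Ordinal ltk; pose E := [set i : 'I_(k + j).+1 | x < i].
have xE : x \notin E by rewrite inE ltnn.
have cE : #|E| = j.
  have -> : E = [set rshift k.+1 i | i : 'I_j].
    apply/setP => i; rewrite inE; apply/idP/imsetP => /= [lti|[i' _ ->]].
      have lt' : i - k.+1 < j by have := ltn_ord i; lia.
      by exists (Ordinal lt') => //; apply/val_inj => /=; lia.
    by rewrite /=; lia.
  by rewrite card_imset ?card_ord // => i1 i2 /(congr1 val) /addnI /val_inj.
have := cardsD1 x [set: 'I_(k + j).+1]; rewrite inE cardsT card_ord => -[] /[!add0n] cT.
transitivity (singleton_free ([set: 'I_(k + j).+1] :\ x) E).
  rewrite -(card_partitions_singleton _ _ _ _ (in_setT x) xE).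
  apply: eq_card => P; rewrite !inE; congr (_ && _).
  apply/existsP/andP => [[i /and3P[/eqP ik iP /forallP nP]]|[xP /forall_inP nP]].
    have -> : x = i by apply/val_inj.
    split=> //; apply/forall_inP => y; rewrite inE => lxy.
    by apply: (implyP (nP y)); rewrite ik.
  exists x; rewrite eqxx xP; apply/forallP => y; apply/implyP => lxy.
  by apply: nP; rewrite inE.
rewrite singleton_free_bell_diff ?cE -?cT //.
by apply/subsetP => y; rewrite !inE andbT; apply: contraTneq => ->; rewrite ltnn.
Qed.

Lemma bell_sum_Anum (k n : nat) :
  bell (k + n) = \sum_(j < n.+1) 'C(n, j) * Anum (k + j) k.
Proof.
transitivity (singleton_free [set: 'I_(k + n)] set0).
  by rewrite singleton_free_bell_diff ?sub0set // cards0 cardsT card_ord.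
rewrite (singleton_free_sum_bin _ _ _ k n) ?sub0set //; last first.
  by rewrite cards0 cardsT card_ord addn0.
by apply: eq_bigr => j _; rewrite cards0 addn0 add0n Anum_bell_diff.
Qed.

(** * Binomial transforms *)

Local Open Scope ring_scope.

(** The added coefficients vanish. A range independent of [m] lets double sums be exchanged. *)
Lemma sum_bin_widen (R : pzSemiRingType) (m n : nat) (f : nat -> R) :
    (m <= n)%N ->
  \sum_(i < m.+1) 'C(m, i)%:R * f i = \sum_(i < n.+1) 'C(m, i)%:R * f i.
Proof.
move=> lemn; rewrite (big_ord_widen n.+1 (fun i => 'C(m, i)%:R * f i)) //.
rewrite big_mkcond; apply: eq_bigr => i _.
by case: ltnP => // ltmi; rewrite bin_small // mul0r.
Qed.

(** Both sides are the trinomial coefficient of [i], [j], [n - i - j], and both vanish when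
    [i + j > n]. *)
Lemma mul_bin_subC (n i j : nat) :
  (i <= n)%N -> (j <= n)%N ->
  ('C(n, i) * 'C(n - i, j) = 'C(n, j) * 'C(n - j, i))%N.
Proof.
move=> lein lejn; have [le_ij|lt_ij] := leqP (i + j) n; last first.
  by rewrite (@bin_small (n - i)) ?(@bin_small (n - j)) ?muln0 //; lia.
have f1 := @bin_fact n i lein; have f2 := @bin_fact n j lejn.
have f3 : ('C(n - i, j) * (j`! * (n - i - j)`!) = (n - i)`!)%N.
  by apply: bin_fact; lia.
have f4 : ('C(n - j, i) * (i`! * (n - i - j)`!) = (n - j)`!)%N.
  by rewrite subnAC; apply: bin_fact; lia.
have h : (0 < i`! * j`! * (n - i - j)`!)%N by rewrite !muln_gt0 !fact_gt0.
apply/eqP; rewrite -(eqn_pmul2r h); apply/eqP.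
transitivity n`!; first by rewrite -f1 -f3; ring.
by rewrite -f2 -f4; ring.
Qed.

(* Umbrally both sides are [(a + d + 1)^n]: the binomial transform may be moved
   from one factor of a binomial convolution to the other. *)
Lemma bin_conv_transform (R : comPzSemiRingType) (a b c d : nat -> R) (n : nat) :
    (forall m, b m = \sum_(i < m.+1) 'C(m, i)%:R * a i) ->
    (forall m, c m = \sum_(i < m.+1) 'C(m, i)%:R * d i) ->
  \sum_(0 <= j < n.+1) 'C(n, j)%:R * a j * c (n - j)%N =
  \sum_(0 <= j < n.+1) 'C(n, j)%:R * b j * d (n - j)%N.
Proof.
move=> bE cE; rewrite !big_mkord.
transitivity (\sum_(j < n.+1) \sum_(i < n.+1)
    ('C(n, j) * 'C(n - j, i))%:R * (a j * d i)).
  apply: eq_bigr => j _; rewrite cE (sum_bin_widen _ _ _ _ (leq_subr j n)).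
  by rewrite mulr_sumr; apply: eq_bigr => i _; rewrite natrM mulrACA.
(* After reversing the right-hand sum, [i] is the index of [d] on both sides. *)
rewrite exchange_big [RHS](reindex_inj rev_ord_inj) /=; apply: eq_bigr => i _.
have lein : (i <= n)%N by rewrite -ltnS.
rewrite subSS subKn // bin_sub // bE.
rewrite (sum_bin_widen _ _ _ _ (leq_subr i n)) mulr_sumr mulr_suml.
apply: eq_bigr => j _; rewrite mul_bin_subC //; last by rewrite -ltnS.
by rewrite natrM !mulrA.
Qed.

Lemma bell_polyS (m : nat) :
  bell_poly m.+1 = \sum_(i < m.+1) 'C(m, i)%:R * ('X * bell_poly i).
Proof.
rewrite /bell_poly big_mkord big_ord_recl stirling2S0 mul0r add0r.
transitivity (\sum_(j < m.+1) \sum_(i < m.+1)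
    'C(m, i)%:R * ((stirling2 i j)%:R * 'X^(j.+1)) : {poly rat}).
  apply: eq_bigr => j _; rewrite lift0 stirling2SS natr_sum mulr_suml.
  by apply: eq_bigr => i _; rewrite natrM mulrA.
rewrite exchange_big; apply: eq_bigr => i _; rewrite -mulr_sumr; congr (_ * _).
(* The sum in [bell_poly i] may run up to [m], since [stirling2 i j] is zero for [i < j]. *)
rewrite big_mkord mulr_sumr [RHS](big_ord_widen m.+1
  (fun j => 'X * ((stirling2 i j)%:R * 'X^j) : {poly rat})) //.
rewrite [RHS]big_mkcond; apply: eq_bigr => j _; rewrite exprS mulrCA.
by case: ltnP => // ltij; rewrite stirling2_small // mul0r mulr0.
Qed.

(** * Pascal's rule and Vandermonde's identity for binomial polynomials *)

Lemma binom_poly0 (p : {poly rat}) : binom_poly p 0 = 1.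
Proof. by rewrite /binom_poly big_geq // invr1 scale1r. Qed.

Lemma binom_polyS (p : {poly rat}) (k : nat) :
  binom_poly (p + 1) k.+1 = binom_poly p k.+1 + binom_poly p k.
Proof.
have k0 : k.+1%:R != 0 :> rat by rewrite Num.Theory.pnatr_eq0.
rewrite /binom_poly factS natrM invfM.
have kV : (k`!%:R)^-1 = (k.+1%:R)^-1 / k`!%:R * k.+1%:R :> rat.
  by rewrite mulrAC mulVf // mul1r.
(* With the inverse of [k.+1]! factored out, both sides share the product of [p - i] for [i < k],
   and what remains is [p + 1 = (p - k) + (k + 1)]. *)
rewrite [X in _ = _ + X *: _]kV -[X in _ = _ + X]scalerA -scalerDr; congr (_ *: _).
rewrite big_nat_recl // [X in _ = X + _]big_nat_recr //= subr0.
under eq_bigr => i _ do rewrite -natr1 opprD addrACA subrr addr0.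
rewrite -[k.+1%:R *: _]mul_polyC polyC_natr -natr1.
by ring.
Qed.

(** Induction on [m] by Pascal's rule, which needs both [r.+1] and [r] at the same [m]; hence [r] is
    kept independent of [m]. *)
Lemma binom_poly_addn (p : {poly rat}) (m r : nat) :
  binom_poly (p + m%:R) r = \sum_(i < r.+1) 'C(m, r - i)%:R * binom_poly p i.
Proof.
elim: m r => [|m IHm] r.
  rewrite addr0 big_ord_recr /= subnn mul1r big1 ?add0r // => i _.
  by rewrite bin0n subn_eq0 leqNgt ltn_ord mul0r.
rewrite -natr1 addrA; case: r => [|r].
  by rewrite big_ord1 bin0 mul1r !binom_poly0.
rewrite binom_polyS !IHm [RHS]big_ord_recr [in LHS]big_ord_recr /= subnn !bin0.
rewrite addrAC -big_split /=; congr (_ + _); apply: eq_bigr => i _.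
by rewrite subSn ?leq_ord // binS natrD mulrDl.
Qed.

Lemma binom_poly_vandermonde (p : {poly rat}) (m : nat) :
  binom_poly (p + m%:R) m = \sum_(i < m.+1) 'C(m, i)%:R * binom_poly p i.
Proof.
rewrite binom_poly_addn; apply: eq_bigr => i _.
by rewrite bin_sub // -ltnS.
Qed.

Theorem theorem3p6 (n k : nat) :
  let y : {poly rat} := 'X in
  [/\ \sum_(0 <= j < n.+1)
        'C(n, j)%:R * (Anum (k + j) k)%:R * (y + 1) ^+ (n - j)
      = \sum_(0 <= j < n.+1)
        'C(n, j)%:R * (bell (k + j))%:R * y ^+ (n - j),
      \sum_(0 <= j < n.+1)
        'C(n, j)%:R * (Anum (k + j) k)%:R * bell_poly (n - j + 1)
      = y * \sum_(0 <= j < n.+1)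
        'C(n, j)%:R * (bell (k + j))%:R * bell_poly (n - j)
    & \sum_(0 <= j < n.+1)
        'C(n, j)%:R * binom_poly (y + (n - j)%:R) (n - j)
          * (Anum (k + j) k)%:R
      = \sum_(0 <= j < n.+1)
        'C(n, j)%:R * binom_poly y (n - j) * (bell (k + j))%:R].
Proof.
move=> y.
have bE m : (bell (k + m))%:R =
    \sum_(i < m.+1) 'C(m, i)%:R * (Anum (k + i) k)%:R :> {poly rat}.
  rewrite bell_sum_Anum natr_sum; apply: eq_bigr => i _.
  by rewrite natrM.
split.
- apply: (bin_conv_transform _ _ _ (fun m => (y + 1) ^+ m)
           (fun m => y ^+ m) n bE) => m.
  rewrite addrC exprDn; apply: eq_bigr => i _.
  by rewrite expr1n mul1r mulr_natl.
(* The outer [y] is absorbed into the last factor, because the transform yielding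
   [bell_poly (m + 1)] is that of [y * bell_poly m]. *)
- rewrite mulr_sumr.
  under [RHS]eq_bigr => j _ do rewrite mulrCA.
  apply: (bin_conv_transform _ _ _ (fun m => bell_poly (m + 1))
           (fun m => y * bell_poly m) n bE) => m.
  by rewrite addn1 bell_polyS.
- under eq_bigr => j _ do rewrite mulrAC.
  under [RHS]eq_bigr => j _ do rewrite mulrAC.
  apply: (bin_conv_transform _ _ _ (fun m => binom_poly (y + m%:R) m)
           (fun m => binom_poly y m) n bE) => m.
  exact: binom_poly_vandermonde.
Qed.
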